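(* Let $c(n)$ denote the number of partitions of $n$ in which the number of parts is a part, and let $e(n)$ denote the number of partitions of $n$ in which the number of parts is not a part. Then \begin{align*} \sum_{N=1}^{\infty} c(N) q^N &= q+\sum_{n=2}^{\infty} \sum_{m=0}^{n} \left[\begin{matrix} 2n-m-2\\ n-m-1\end{matrix}\right]_q\frac{q^{mn+2n-1}}{(q;q)_{m}}=\frac{q}{(q^2;q)_{\infty}},\\ \sum_{N=1}^{\infty} e(N) q^N &= 1+\frac{q^2}{1-q}+\sum_{n=2}^{\infty} \sum_{m=0}^{n} \left[\begin{matrix} 2n-m-2\\ n-m\end{matrix}\right]_q\frac{q^{mn+n}}{(q;q)_{m}}=\frac{1-q+q^2}{(q;q)_{\infty}}. \end{align*}
   Context: Here $|q|<1$, $(a;q)_0=1$, $(a;q)_n=(1-a)(1-aq)\cdots(1-aq^{n-1})$, $(a;q)_\infty=\lim_{n\to\infty}(a;q)_n$, and the Gaussian polynomial is $\left[\begin{matrix} N\\ n\end{matrix}\right]_q=\frac{(q;q)_N}{(q;q)_n(q;q)_{N-n}}$ if $0\le n\le N$ and $0$ otherwise. The empty partition is counted in $e(0)=1$ (the leading $1$ in the second identity).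
   Formalization: In the second identity the series of e(N)q^N is summed from N=0 (with e(0)=1 for the empty partition) instead of from N=1; as printed, the identity fails, for example at q=0, where the left side is 0 and the right side is 1. *)

(* Defs.v *)
From HB Require Import structures.
From mathcomp Require Import all_boot all_order all_algebra.
From mathcomp Require Import all_classical all_reals all_analysis.
From mathcomp Require Import complex.

Set Implicit Arguments.
Unset Strict Implicit.
Unset Printing Implicit Defensive.

Import Order.TTheory GRing.Theory Num.Theory.
Import numFieldNormedType.Exports.

Local Open Scope ring_scope.

Definition is_partition (n : nat) (s : seq nat) : bool :=
  [&& sorted geq s, 0%N \notin s & sumn s == n].

(* A partition of n has at most n parts, each at most n, so it is the list of
   values of a unique element of the finite type n.-bseq 'I_n.+1
   (see partition_of_bseq). *)
Definition parts_of (n : nat) (b : n.-bseq 'I_n.+1) : seq nat :=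
  [seq val i | i <- b].

Definition partitions (n : nat) : {set n.-bseq 'I_n.+1} :=
  [set b | is_partition n (parts_of b)].

Definition num_c (n : nat) : nat :=
  #|[set b in partitions n | size (parts_of b) \in parts_of b]|.

Definition num_e (n : nat) : nat :=
  #|[set b in partitions n | size (parts_of b) \notin parts_of b]|.

Lemma parts_of_inj n : injective (@parts_of n).
Proof. by move=> b b' /(inj_map val_inj)/val_inj. Qed.

Lemma partition_of_bseq n s :
  is_partition n s -> exists b : n.-bseq 'I_n.+1, parts_of b = s.
Proof.
case/and3P=> _ s0 /eqP sn.
have szs : (size s <= n)%N.
  rewrite -sn; elim: s s0 {sn} => //= x s IHs.
  by rewrite inE negb_or eq_sym -lt0n => /andP[x0 /IHs]; apply: (leq_add x0).
have les x : x \in s -> (x <= n)%N.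
  rewrite -sn; elim: s {s0 sn szs} => //= y s IHs; rewrite inE.
  case/predU1P=> [->|/IHs xs]; first exact: leq_addr.
  exact: leq_trans xs (leq_addl _ _).
have sz : (size [seq (inord x : 'I_n.+1) | x <- s] <= n)%N by rewrite size_map.
exists (Bseq sz); rewrite /parts_of /= -map_comp.
by apply: map_id_in => x xs /=; rewrite inordK // ltnS les.
Qed.

Definition qpoch {K : numFieldType} (a q : K) (n : nat) : K :=
  \prod_(i < n) (1 - a * q ^+ i).

Definition qpoch_inf {K : numFieldType} (a q : K) : K := limn (qpoch a q).

(* The arguments are integers because the lower index can be -1. *)
Definition gauss_binom {K : numFieldType} (N n : int) (q : K) : K :=
  if (0 <= n) && (n <= N) then
    qpoch q q `|N|%N / (qpoch q q `|n|%N * qpoch q q `|N - n|%N)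
  else 0.

Definition partial_sums {K : numFieldType} (m : nat) (u : nat -> K) : nat -> K :=
  fun k => \sum_(m <= n < k) u n.

Definition converges {K : numFieldType} (m : nat) (u : nat -> K) : Prop :=
  cvgn (partial_sums m u).

Definition infsum {K : numFieldType} (m : nat) (u : nat -> K) : K :=
  limn (partial_sums m u).

(* Main.v *)
(* Deleting the part equal to the number of parts and adding 1 to every other
   part turns a partition of N in which the number of parts is a part into a
   partition of N - 1 without the part 1, so c(N) = p(N - 1) - p(N - 2), and
   e(N) = p(N) - c(N).
   The inner sums of the double series are q^(2n-1) / (q;q)_(n-1) and
   q^n / (q;q)_n - q^(2n-1) / (q;q)_(n-1), both by an induction on the upper
   parameter of the Gaussian polynomials, and the resulting series telescope
   because sum_(n <= k) q^n / (q;q)_n = 1 / (q;q)_k.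
   It remains that sum p(N) q^N = 1 / (q;q)_oo.  With p_k(N) counting
   partitions into parts at most k, |q| < r < 1 and s = |q| / r, one has
   p_k(N) r^N <= 1 / (r;r)_k, hence p_k(N) |q|^N = O(s^N) uniformly in k; this
   bounds the truncation errors in (1 - q^k) F_k = F_(k-1) and gives
   (q;q)_N * sum_(i < N) p(i) q^i = 1 + O(s^N). *)

Require Import Defs.
From HB Require Import structures.
From mathcomp Require Import all_boot all_order all_algebra.
From mathcomp Require Import all_classical all_reals all_analysis.
From mathcomp Require Import complex.
From mathcomp Require Import zify ring lra.

Set Implicit Arguments.
Unset Strict Implicit.
Unset Printing Implicit Defensive.

Import Order.TTheory GRing.Theory Num.Theory.
Import numFieldNormedType.Exports.

Local Open Scope ring_scope.
Local Open Scope complex_scope.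

(** * Counting partitions as lists, and the bijection principle *)

Definition count_partitions (n : nat) (P : pred (seq nat)) : nat :=
  #|[set b in partitions n | P (parts_of b)]|.

(** Lists freed from the length bounds of the [bseq] encoding, so that bijections can be written as
    plain maps on lists. *)
Definition partition_seq (n : nat) : seq (seq nat) :=
  [seq parts_of b | b in partitions n].

Lemma partition_seq_uniq n : uniq (partition_seq n).
Proof. by rewrite map_inj_uniq ?enum_uniq //; apply: parts_of_inj. Qed.

Lemma mem_partition_seq n s : (s \in partition_seq n) = is_partition n s.
Proof.
apply/mapP/idP => [[b + ->]|/[dup] sP /partition_of_bseq[b bs]].
  by rewrite mem_enum inE.
by exists b; rewrite ?mem_enum ?inE bs.
Qed.

Lemma count_partitionsE n P :
  count_partitions n P = count P (partition_seq n).
Proof.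
rewrite /count_partitions /partition_seq /image_mem count_map -size_filter cardE.
rewrite /enum_mem -filter_predI; congr (size _).
by apply: eq_filter => b /=; rewrite !inE andbC.
Qed.

(** [f] and [g] are inverse to each other on the partitions being counted, so the image of one
    enumeration is a permutation of the other. *)
Lemma count_partitions_bij m n (P Q : pred (seq nat)) (f g : seq nat -> seq nat) :
    (forall s, is_partition m s -> P s ->
      [/\ is_partition n (f s), Q (f s) & g (f s) = s]) ->
    (forall t, is_partition n t -> Q t ->
      [/\ is_partition m (g t), P (g t) & f (g t) = t]) ->
  count_partitions m P = count_partitions n Q.
Proof.
move=> fP gP; rewrite !count_partitionsE -!size_filter.
rewrite -(size_map f); apply: perm_size; apply: uniq_perm.
- rewrite map_inj_in_uniq ?filter_uniq ?partition_seq_uniq // => s t.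
  rewrite !mem_filter !mem_partition_seq => /andP[Ps ps] /andP[Pt pt] eqf.
  by have [_ _ <-] := fP s ps Ps; rewrite eqf; have [_ _ ->] := fP t pt Pt.
- by rewrite filter_uniq ?partition_seq_uniq.
move=> t; apply/mapP/idP => [[s + ->]|]; rewrite !mem_filter !mem_partition_seq.
  by case/andP=> Ps ps; have [-> -> _] := fP s ps Ps.
case/andP=> Qt qt; have [pg Pg eqt] := gP t qt Qt.
by exists (g t); rewrite // mem_filter mem_partition_seq Pg.
Qed.

Lemma count_partitionsID n (P Q : pred (seq nat)) :
  count_partitions n P = (count_partitions n (predI P Q)
                          + count_partitions n (predI P (predC Q)))%N.
Proof.
rewrite !count_partitionsE; elim: (partition_seq n) => //= s ss ->.
by case: (P s); case: (Q s) => /=; lia.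
Qed.

Lemma eq_count_partitions n (P Q : pred (seq nat)) :
  (forall s, is_partition n s -> P s = Q s) ->
  count_partitions n P = count_partitions n Q.
Proof.
move=> eqPQ; rewrite !count_partitionsE; apply: eq_in_count => s.
by rewrite mem_partition_seq; apply: eqPQ.
Qed.

Lemma geq_total : total geq.
Proof. by move=> x y; apply: leq_total. Qed.

Lemma geq_trans : transitive geq.
Proof. by move=> y x z /= xy yz; apply: leq_trans yz xy. Qed.

Lemma geq_anti : antisymmetric geq.
Proof. by move=> x y /= /andP[? ?]; apply/eqP; rewrite eqn_leq; apply/andP. Qed.

Lemma sort_perm_id s t : sorted geq s -> perm_eq t s -> sort geq t = s.
Proof.
move=> ss ts; apply: (sorted_eq geq_trans geq_anti) => //.
  exact: sort_sorted geq_total _.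
by rewrite perm_sort.
Qed.

Lemma is_partition_sort n s :
  is_partition n (sort geq s) = (0%N \notin s) && (sumn s == n).
Proof.
rewrite /is_partition (sort_sorted geq_total) mem_sort.
by rewrite (perm_sumn (permEl (perm_sort geq s))).
Qed.

Lemma sorted_rem x s : sorted geq s -> sorted geq (rem x s).
Proof. by apply: subseq_sorted; [apply: geq_trans|apply: rem_subseq]. Qed.

Lemma sumn_rem x s : x \in s -> sumn s = (x + sumn (rem x s))%N.
Proof. by move/perm_to_rem/perm_sumn=> ->. Qed.

Lemma rem_sort_cons x t : sorted geq t -> rem x (sort geq (x :: t)) = t.
Proof.
move=> st; apply: (sorted_eq geq_trans geq_anti) => //.
  exact/sorted_rem/sort_sorted/geq_total.
have /perm_to_rem eqt : x \in sort geq (x :: t) by rewrite mem_sort mem_head.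
by rewrite -(perm_cons x) -(permPl eqt) perm_sort.
Qed.

(** Removing one copy of [x] is inverse to inserting one and sorting again. The conditions on [P]
    make it blind to order and to copies of [x], so it survives both maps. *)
Lemma count_partitions_mem n x (P : pred (seq nat)) :
    (0 < x)%N -> (forall s t, perm_eq s t -> P s = P t) ->
    (forall s, P (x :: s) = P s) ->
  count_partitions (n + x) (predI P (fun s => x \in s)) = count_partitions n P.
Proof.
move=> x0 permP consP.
apply: (count_partitions_bij (f := rem x) (g := fun t => sort geq (x :: t))).
  move=> s /and3P[ss s0 /eqP sn] /andP[/= Ps xs]; split.
  - apply/and3P; split; first exact: sorted_rem.
      by apply: contra s0 => /mem_rem.
    by apply/eqP; move: sn; rewrite (sumn_rem xs); lia.
  - by rewrite -consP (permP _ s) // perm_sym perm_to_rem.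
  - by apply: sort_perm_id; rewrite // perm_sym perm_to_rem.
move=> t /and3P[st t0 /eqP tn] Pt; split.
- by rewrite is_partition_sort inE negb_or eq_sym -lt0n x0 t0 /= tn addnC.
- rewrite /= mem_sort mem_head andbT (permP _ (x :: t)) ?consP //.
  by rewrite perm_sort.
- exact: rem_sort_cons.
Qed.

(** * Partitions with parts at most k *)

Definition bounded_partitions (k n : nat) : nat :=
  count_partitions n (all (fun x => x <= k)%N).

Lemma is_partition_nil n : is_partition n [::] = (n == 0%N).
Proof. by rewrite /is_partition /= eq_sym. Qed.

Lemma is_partition_part_le n s x : is_partition n s -> x \in s -> (x <= n)%N.
Proof. by case/and3P=> _ _ /eqP<- /sumn_rem->; apply: leq_addr. Qed.

Lemma bounded_partitions0 n : bounded_partitions 0 n = (n == 0%N).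
Proof.
rewrite /bounded_partitions (@eq_count_partitions _ _ (pred1 [::])).
  by rewrite count_partitionsE count_uniq_mem ?partition_seq_uniq //
             mem_partition_seq is_partition_nil.
move=> [//|x s] /and3P[_ + _] /=; rewrite inE negb_or eq_sym => /andP[x0 _].
by rewrite leqn0 (negPf x0).
Qed.

(** Separates the partitions by whether k+1 occurs and removes one copy if it does. On coefficients
    this is (1 - q^(k+1)) F_(k+1) = F_k, with F_k the generating function of
    [bounded_partitions k]. *)
Lemma bounded_partitionsS k n :
  bounded_partitions k.+1 n = (bounded_partitions k n +
    if k.+1 <= n then bounded_partitions k.+1 (n - k.+1) else 0)%N.
Proof.
rewrite {1}/bounded_partitions (count_partitionsID _ _ (fun s => k.+1 \in s)).
rewrite addnC; congr addn.
  apply: eq_count_partitions => s _ /=; elim: s => //= x s IHs.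
  rewrite inE negb_or -IHs [k.+1 == x]eq_sym.
  have -> : (x <= k)%N = (x != k.+1) && (x <= k.+1)%N by rewrite -ltn_neqAle.
  by case: (x == _); case: (x <= _)%N; rewrite ?andbF ?andbT.
case: leqP => [nk|kn]; last first.
  rewrite /bounded_partitions -[RHS](@count_partitions_mem _ k.+1) ?subnK //.
    by move=> s t /perm_all->.
  by move=> s /=; rewrite leqnn.
apply/eqP; rewrite count_partitionsE eqn0Ngt -has_count; apply/hasPn => s.
rewrite mem_partition_seq => sP /=; apply/negP => /andP[_].
by move/(is_partition_part_le sP) => kn; lia.
Qed.

Definition num_partitions (n : nat) : nat := #|partitions n|.

Lemma num_partitionsE n : num_partitions n = count_partitions n predT.
Proof. by apply: eq_card => b; rewrite !inE andbT. Qed.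

Lemma bounded_partitions_full k n :
  (n <= k)%N -> bounded_partitions k n = num_partitions n.
Proof.
move=> nk; rewrite num_partitionsE; apply: eq_count_partitions => s sP /=.
by apply/allP => x /(is_partition_part_le sP)/leq_trans; apply.
Qed.

Lemma num_c_e n : (num_c n + num_e n)%N = num_partitions n.
Proof.
rewrite num_partitionsE (count_partitionsID _ _ (fun s => size s \in s)).
by congr addn; apply: eq_card => b; rewrite !inE.
Qed.

(** * Partitions without the part 1, and the formula for c(n) *)

Definition no_ones (n : nat) : nat := count_partitions n (fun s => 1%N \notin s).

Lemma no_ones0 : no_ones 0 = 1%N.
Proof.
rewrite /no_ones (@eq_count_partitions _ _ (all (fun x => x <= 0)%N)).
  exact: bounded_partitions0.
move=> s sP; transitivity true; last symmetry.
  by apply/negP => /(is_partition_part_le sP).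
by apply/allP => x /(is_partition_part_le sP).
Qed.

(** Partitions of n+1 that do have a part 1 become arbitrary partitions of n when one 1 is
    deleted. *)
Lemma no_onesS n : (no_ones n.+1 + num_partitions n)%N = num_partitions n.+1.
Proof.
rewrite !num_partitionsE (count_partitionsID n.+1 predT (fun s => 1%N \in s)) addnC.
by congr addn; rewrite -addn1 count_partitions_mem.
Qed.

Lemma num_c0 : num_c 0 = 0%N.
Proof.
rewrite /num_c -/(count_partitions _ (fun s => size s \in s)).
rewrite (@eq_count_partitions _ _ pred0) ?count_partitionsE ?count_pred0 // => s sP.
apply/negP => /[dup] szs /(is_partition_part_le sP).
by rewrite leqn0 => /nilP s0; rewrite s0 in szs.
Qed.

Lemma num_cS n : num_c n.+1 = no_ones n.
Proof.
rewrite /num_c -/(count_partitions _ (fun s => size s \in s)).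
apply: (count_partitions_bij
  (f := fun s => map S (rem (size s) s))
  (* Inserting one part makes [(size t).+1] parts, so exactly this value has to be inserted. *)
  (g := fun t => sort geq ((size t).+1 :: map predn t))).
  move=> s /and3P[ss s0 /eqP sn] sz_s.
  have szr := size_rem sz_s.
  have sumS t : sumn (map S t) = (sumn t + size t)%N.
    by elim: t => //= x t ->; lia.
  split.
  - apply/and3P; split.
    + by rewrite sorted_map; apply: sorted_rem.
    + by apply/negP => /mapP[].
    (* Deletion takes [size s] off the sum; raising the remaining [size s - 1] parts gives all but 1
       of it back. *)
    + apply/eqP; rewrite sumS szr; move: sn; rewrite (sumn_rem sz_s).
      by case: (s) sz_s => //=; lia.
  - apply/negP => /mapP[x xs [x0]]; move: s0; rewrite x0.
    by rewrite (mem_rem xs).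
  - rewrite -map_comp map_id size_map szr prednK; last by case: (s) sz_s.
    by apply: sort_perm_id; rewrite // perm_sym perm_to_rem.
move=> t /and3P[st t0 /eqP tn] t1.
have tK : map S (map predn t) = t.
  rewrite -map_comp map_id_in // => x xt /=; rewrite prednK // lt0n.
  by apply: contraNneq t0 => <-.
have szg : size (sort geq ((size t).+1 :: map predn t)) = (size t).+1.
  by rewrite size_sort /= size_map.
have sumP : (sumn (map predn t) + size t)%N = n.
  rewrite -tn -[in RHS]tK -[in LHS](size_map predn); elim: (map _ t) => //= x u <-.
  lia.
split.
- rewrite is_partition_sort inE negb_or /=; apply/andP; split; last first.
    by apply/eqP; move: sumP; lia.
  (* A part 0 in the image would come from a 0 or a 1 in [t]; both are excluded. *)
  apply/negP => /mapP[[|[|x]] xt //]; first by rewrite xt in t0.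
  by rewrite xt in t1.
- by rewrite szg mem_sort mem_head.
- rewrite szg rem_sort_cons // sorted_map.
  by apply: sub_sorted st => x y /=; lia.
Qed.

(** * Finite q-identities evaluating the inner sums *)

Section QIdentities.
Variables (K : numFieldType) (q : K).
Hypothesis q_norm_lt1 : `|q| < 1.

Lemma subr1_expS_neq0 k : 1 - q ^+ k.+1 != 0.
Proof.
rewrite subr_eq0 eq_sym; apply/eqP => qk1.
have : `|q| ^+ k.+1 < 1 by rewrite exprn_ilt1.
by rewrite -normrX qk1 normr1 ltxx.
Qed.

Local Notation Q := (qpoch q q).

Lemma qpoch0 : Q 0 = 1.
Proof. by rewrite /qpoch big_ord0. Qed.

Lemma qpochS k : Q k.+1 = Q k * (1 - q ^+ k.+1).
Proof. by rewrite /qpoch big_ord_recr /= -exprS. Qed.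

Lemma qpoch_neq0 k : Q k != 0.
Proof.
elim: k => [|k IHk]; rewrite ?qpoch0 ?oner_eq0 // qpochS.
by rewrite mulf_neq0 // subr1_expS_neq0.
Qed.

Lemma qpoch_sqrE k : qpoch (q ^+ 2) q k = Q k.+1 / (1 - q).
Proof.
rewrite /qpoch big_ord_recl /= expr0 mulr1 mulrAC divff ?mul1r; last first.
  by have := subr1_expS_neq0 0.
by apply: eq_bigr => i _; rewrite -exprD -exprS.
Qed.

(** The Gaussian polynomial with upper index a+j and lower index j; in these parameters it is never
    outside its range. *)
Definition qbin (a j : nat) : K := Q (a + j) / (Q j * Q a).

Lemma gauss_binomE (a j : nat) : gauss_binom (a + j)%:Z j%:Z q = qbin a j.
Proof.
rewrite /gauss_binom lez_nat leq_addl /= /qbin; congr (_ / (_ * Q _)).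
by lia.
Qed.

Lemma qbin0r a : qbin a 0 = 1.
Proof. by rewrite /qbin addn0 qpoch0 mul1r divff ?qpoch_neq0. Qed.

Lemma qbin0l j : qbin 0 j = 1.
Proof. by rewrite /qbin add0n qpoch0 mulr1 divff ?qpoch_neq0. Qed.

(** The q-Pascal rule: once q^(a+j+2) is split as a product, it is an identity of rational
    functions. *)
Lemma qbinSS a j : qbin a.+1 j.+1 = qbin a j.+1 + q ^+ a.+1 * qbin a.+1 j.
Proof.
rewrite /qbin !addSn !addnS !qpochS.
have qE : q ^+ (a + j).+2 = q ^+ a.+1 * q ^+ j.+1 by rewrite -exprD addSn addnS.
rewrite qE; have := qpoch_neq0 a; have := qpoch_neq0 j.
have := subr1_expS_neq0 a; have := subr1_expS_neq0 j.
by move=> *; field; apply/and4P.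
Qed.

(** Write q^m = 1 - (1 - q^m). Since (1 - q^m) / Q m = 1 / Q (m-1), the correction is the same sum
    with its index shifted, which brings out the factor x. *)
Lemma sum_mul_expSr_qpochV (b : nat -> K) x k :
  \sum_(m < k.+2) b (k.+1 - m)%N * ((q * x) ^+ m / Q m) =
    \sum_(m < k.+2) b (k.+1 - m)%N * (x ^+ m / Q m)
    - x * \sum_(m < k.+1) b (k - m)%N * (x ^+ m / Q m).
Proof.
rewrite big_ord_recl [X in _ = X - _]big_ord_recl /= !expr0 -addrA; congr (_ + _).
rewrite mulr_sumr -sumrB; apply: eq_bigr => m _.
rewrite /bump /= !add1n subSS qpochS exprMn [x ^+ m.+1]exprS.
have := qpoch_neq0 m; have := subr1_expS_neq0 m => *.
by field; apply/andP.
Qed.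

(** Telescopes, because q^(k+1) / Q (k+1) = 1 / Q (k+1) - 1 / Q k. *)
Lemma sum_expr_qpochV k : \sum_(m < k.+1) q ^+ m / Q m = (Q k)^-1.
Proof.
elim: k => [|k IHk]; first by rewrite big_ord1 expr0 div1r.
rewrite big_ord_recr /= IHk qpochS.
have := qpoch_neq0 k; have := subr1_expS_neq0 k => *.
by field; apply/andP.
Qed.

(* Both sides count partitions into at most k parts; on the left they are
   sorted by the number m of parts larger than a. *)
Lemma sum_qbin_expr a k :
  \sum_(m < k.+1) qbin a (k - m) * ((q ^+ a.+1) ^+ m / Q m) = (Q k)^-1.
Proof.
elim: a k => [|a IHa] k.
  rewrite -sum_expr_qpochV; apply: eq_bigr => m _.
  by rewrite qbin0l mul1r expr1.
case: k => [|k]; first by rewrite big_ord1 qbin0r mul1r expr0 div1r.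
(* Lowering q^(a+2) to q^(a+1) costs a shifted sum, and the q-Pascal rule absorbs it by turning
   [qbin a.+1] into [qbin a]. *)
rewrite -(IHa k.+1) [q ^+ a.+2]exprS sum_mul_expSr_qpochV.
rewrite big_ord_recr [in RHS]big_ord_recr /= subnn !qbin0r addrAC; congr (_ + _).
rewrite mulr_sumr -sumrB; apply: eq_bigr => m _.
have mk : (m <= k)%N by rewrite -ltnS.
by rewrite subSn // qbinSS; ring.
Qed.

Lemma sum_qbin_exprS a k :
  \sum_(m < k.+2) qbin a (k.+1 - m) * ((q ^+ a.+2) ^+ m / Q m) =
    (Q k.+1)^-1 - q ^+ a.+1 / Q k.
Proof. by rewrite [q ^+ a.+2]exprS sum_mul_expSr_qpochV !sum_qbin_expr. Qed.

Lemma c_doubleE k :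
  \sum_(0 <= m < k.+2)
      gauss_binom (2 * k.+1%:Z - m%:Z - 2) (k.+1%:Z - m%:Z - 1) q
        * (q ^+ (m * k.+1 + 2 * k.+1 - 1) / Q m) = q ^+ k.*2.+1 / Q k.
Proof.
(* The last term m = n = k+1 has lower index -1, hence vanishes; the others are [qbin k (k - m)]. *)
rewrite big_nat_recr //= {2}/gauss_binom.
rewrite (_ : k.+1%:Z - k.+1%:Z - 1 = -1) //; last by lia.
rewrite /= mul0r addr0 big_mkord -(sum_qbin_expr k k) mulr_sumr.
apply: eq_bigr => m _; have mk : (m <= k)%N by rewrite -ltnS.
rewrite -gauss_binomE (_ : 2 * _ - _ - 2 = (k + (k - m))%N%:Z); last by lia.
rewrite (_ : k.+1%:Z - _ - 1 = (k - m)%N%:Z); last by lia.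
rewrite (_ : (_ + _ - 1)%N = (k.*2.+1 + k.+1 * m)%N); last by lia.
by rewrite exprD exprM; ring.
Qed.

(** With n = k+2 the Gaussian polynomial is [qbin k (n - m)] and q^(mn) is (q^(k+2))^m, the weight
    of [sum_qbin_exprS]. *)
Lemma e_doubleE k :
  \sum_(0 <= m < k.+3)
      gauss_binom (2 * k.+2%:Z - m%:Z - 2) (k.+2%:Z - m%:Z) q
        * (q ^+ (m * k.+2 + k.+2) / Q m)
  = q ^+ k.+2 / Q k.+2 - q ^+ k.*2.+3 / Q k.+1.
Proof.
have -> : q ^+ k.+2 / Q k.+2 - q ^+ k.*2.+3 / Q k.+1 =
          q ^+ k.+2 * ((Q k.+2)^-1 - q ^+ k.+1 / Q k.+1).
  by rewrite mulrBr mulrA -exprD; congr (_ - q ^+ _ / _); lia.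
rewrite big_mkord -sum_qbin_exprS mulr_sumr.
apply: eq_bigr => m _; have mk : (m <= k.+2)%N by rewrite -ltnS.
rewrite -gauss_binomE (_ : 2 * _ - _ - 2 = (k + (k.+2 - m))%N%:Z); last by lia.
rewrite (_ : k.+2%:Z - _ = (k.+2 - m)%N%:Z); last by lia.
rewrite (_ : (_ + k.+2)%N = (k.+2 + k.+2 * m)%N); last by lia.
by rewrite exprD exprM; ring.
Qed.

End QIdentities.

(** * Geometric bounds, and convergence in [R[i]] reduced to real sequences *)

Lemma sum_geometric_le (K : numFieldType) (x : K) m n :
  0 <= x < 1 -> \sum_(i < n) x ^+ (m + i) <= x ^+ m / (1 - x).
Proof.
move=> /andP[x0 x1]; under eq_bigr do rewrite exprD.
rewrite -mulr_sumr ler_wpM2l ?exprn_ge0 // -div1r ler_pdivlMr ?subr_gt0 //.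
by rewrite mulrC -opprB mulNr -subrX1 opprB gerBl exprn_ge0.
Qed.

Section ComplexConvergence.
Local Open Scope classical_set_scope.
Variable R : realType.
Local Notation C := (R[i] : numFieldType).

Lemma gt0_complex_real (e : C) : 0 < e -> exists2 x : R, 0 < x & e = x%:C.
Proof.
move=> e0; have eE : e = (complex.Re e)%:C by rewrite RRe_real // gtr0_real.
by exists (complex.Re e); rewrite // -ltcR -eE.
Qed.

Lemma norm_complex_real (z : R[i]) : exists2 x : R, 0 <= x & `|z| = x%:C.
Proof.
by exists (complex.Re `|z|); rewrite -?ler0c RRe_real ?normr_real.
Qed.

Lemma cvg_geometric_bound (u : nat -> C) (l : C) (c x : R) :
    0 <= x < 1 -> (forall n, `|u n - l| <= (c * x ^+ n)%:C) ->
  u @ \oo --> l.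
Proof.
move=> /andP[x0 x1] ul; apply/cvgrPdist_le => _ /gt0_complex_real[e e0 ->].
have x1' : `|x| < 1 by rewrite ger0_norm.
have /cvgrPdist_le/(_ _ e0) := cvg_geometric c x1'.
apply: filterS => n; rewrite sub0r normrN => cxn.
rewrite distrC (le_trans (ul n)) // lecR (le_trans _ cxn) //.
by rewrite real_ler_norm // num_real.
Qed.

Lemma cvg_complex (u : nat -> C) (a b : R) :
    complex.Re (u n) @[n --> \oo] --> a -> complex.Im (u n) @[n --> \oo] --> b ->
  u @ \oo --> (a +i* b : C).
Proof.
move=> /cvgrPdist_le ua /cvgrPdist_le ub.
apply/cvgrPdist_le => _ /gt0_complex_real[e e0 ->].
have e2 : 0 < e / 2 by rewrite divr_gt0.
move: (ua _ e2) (ub _ e2); apply: filterS2 => n an bn.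
rewrite [X in `|X|]complexE (le_trans (ler_normD _ _)) //.
rewrite normrM (_ : `|'i| = 1) ?mul1r; last first.
  by rewrite normc_def /= expr0n /= add0r expr1n sqrtr1.
have normR (y : R) : `|y%:C| = `|y|%:C :> R[i].
  by rewrite normc_def /= expr0n /= addr0 sqrtr_sqr.
rewrite !normR -rmorphD lecR (splitr e) lerD //=.
- by move: an; case: (u n).
- by move: bn; case: (u n).
Qed.

(** Real and imaginary parts are each dominated by a geometric series, so they converge absolutely
    in [R]. *)
Lemma cvgn_series_geometric_bound (u : nat -> C) (c x : R) :
    0 <= x < 1 -> (forall n, `|u n| <= (c * x ^+ n)%:C) ->
  cvgn (fun n => \sum_(i < n) u i).
Proof.
move=> /andP[x0 x1] uc.
have cx n : 0 <= c * x ^+ n by rewrite -ler0c (le_trans _ (uc n)).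
have cvgR (f : C -> R) : (forall z, `|f z| <= complex.Re `|z|) -> f 0 = 0 ->
    {morph f : z w / z + w} ->
  exists l : R, f (\sum_(i < n) u i) @[n --> \oo] --> l.
  move=> fle f0 fD; exists (limn (series (f \o u))).
  have -> : (fun n => f (\sum_(i < n) u i)) = series (f \o u).
    by apply/funext => n; rewrite (big_morph f fD f0) /series /= big_mkord.
  apply: normed_cvg; apply: (series_le_cvg _ cx) => //= [n|].
  - rewrite (le_trans (fle _)) //; move: (uc n); rewrite lecE.
    by case/andP.
  - by apply: is_cvg_geometric_series; rewrite ger0_norm.
have [|//|[? ?] [? ?]//|a ua] := cvgR (@complex.Re R).
  by move=> z; have := normc_ge_Re z; rewrite lecE => /andP[].
have [|//|[? ?] [? ?]//|b ub] := cvgR (@complex.Im R).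
  move=> z; rewrite normc_def /= -sqrtr_sqr ler_sqrt ?lerDr ?sqr_ge0 //.
  by rewrite addr_ge0 ?sqr_ge0.
by apply/cvg_ex; exists (a +i* b); apply: cvg_complex.
Qed.

End ComplexConvergence.

(** For 0 <= y <= x one has 1 - y >= exp(- y / (1 - x)), so the product is at least the exponential
    of a convergent sum. The witness uses that this sum is at most x / (1 - x) <= 1 / (1 - x). *)
Lemma qpoch_ge_real (R : realType) (x : R) : 0 <= x < 1 ->
  exists2 d : R, 0 < d & forall k, d <= qpoch x x k.
Proof.
move=> /andP[x0 x1].
have x1' : 0 < 1 - x by rewrite subr_gt0.
suff Qge k : expR (- ((\sum_(i < k) x ^+ i.+1) / (1 - x))) <= qpoch x x k.
  exists (expR (- ((1 - x)^-1 / (1 - x)))); first exact: expR_gt0.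
  move=> k; apply: le_trans (Qge k).
  rewrite ler_expR lerN2; apply: ler_wpM2r; first by rewrite invr_ge0 ltW.
  under eq_bigr do rewrite -add1n.
  have /(sum_geometric_le 1 k) : 0 <= x < 1 by rewrite x0.
  move=> /le_trans; apply.
  by rewrite expr1 ler_piMl ?invr_ge0 1?ltW.
elim: k => [|k IHk]; first by rewrite big_ord0 mul0r oppr0 expR0 /qpoch big_ord0.
rewrite big_ord_recr /= mulrDl opprD expRD qpochS.
apply: ler_pM; rewrite ?expR_ge0 //.
set y := x ^+ k.+1.
have y0 : 0 <= y by rewrite exprn_ge0.
have yx : y <= x by rewrite /y exprS ler_piMr // exprn_ile1 // ltW.
(* In inverse form: 1 / (1 - y) <= 1 + y / (1 - x) <= exp(y / (1 - x)). *)
rewrite expRN -[leRHS]invrK.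
rewrite lef_pV2 ?posrE ?expR_gt0 ?invr_gt0 ?subr_gt0 ?(le_lt_trans yx) //.
apply: le_trans (expR_ge1Dx _).
rewrite -div1r ler_pdivrMr ?subr_gt0 ?(le_lt_trans yx) //.
rewrite -subr_ge0.
have -> : (1 + y / (1 - x)) * (1 - y) - 1 = y * (x - y) / (1 - x).
  by field; rewrite gt_eqF.
by rewrite divr_ge0 ?mulr_ge0 ?subr_ge0 // ltW.
Qed.

(** * Truncated generating functions of bounded partitions and their error bounds *)

Section TruncatedGeneratingFunction.
Variable K : numFieldType.

Definition truncated_gf (k N : nat) (q : K) : K :=
  \sum_(i < N) (bounded_partitions k i)%:R * q ^+ i.

(** The factor q^(k+1) shifts degrees, so cutting at N cuts the second sum at [N - k.+1]; truncated
    subtraction makes that sum empty when N <= k+1. *)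
Lemma truncated_gfS k N q :
  truncated_gf k.+1 N q
  = truncated_gf k N q + q ^+ k.+1 * truncated_gf k.+1 (N - k.+1) q.
Proof.
rewrite /truncated_gf.
under eq_bigr do rewrite bounded_partitionsS natrD mulrDl.
rewrite big_split /=; congr (_ + _); case: (leqP N k.+1) => [Nk|kN].
  rewrite (eqP Nk) big_ord0 mulr0 big1 // => i _.
  by rewrite leqNgt (leq_trans (ltn_ord i)) // mul0r.
rewrite -[in LHS](subnKC (ltnW kN)) big_split_ord /= big1 ?add0r => [|i _].
  rewrite mulr_sumr; apply: eq_bigr => i _.
  by rewrite leq_addr addKn exprD mulrCA.
by rewrite leqNgt ltn_ord /= mul0r.
Qed.

Lemma truncated_gf_le k M N (x : K) :
  0 <= x -> (M <= N)%N -> truncated_gf k M x <= truncated_gf k N x.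
Proof.
move=> x0 MN; rewrite /truncated_gf -[N](subnKC MN) big_split_ord /= lerDl.
by rewrite sumr_ge0 // => i _; rewrite mulr_ge0 ?ler0n ?exprn_ge0.
Qed.

Lemma truncated_gf0 N (x : K) : truncated_gf 0 N.+1 x = 1.
Proof.
rewrite /truncated_gf big_ord_recl bounded_partitions0 expr0 mulr1 big1 ?addr0 //.
by move=> i _; rewrite bounded_partitions0 mul0r.
Qed.

Lemma qpoch_ge0 k (x : K) : 0 <= x < 1 -> 0 <= qpoch x x k.
Proof.
move=> /andP[x0 x1]; apply: prodr_ge0 => i _.
by rewrite subr_ge0 -exprS exprn_ile1 // ltW.
Qed.

(** Coefficients are nonnegative, so the terms lost by truncation only decrease the value: (1 -
    x^(k+1)) F_(k+1) <= F_k for the truncated sums. *)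
Lemma truncated_gf_qpoch_le1 k N (x : K) :
  0 <= x < 1 -> truncated_gf k N x * qpoch x x k <= 1.
Proof.
move=> x01; have /andP[x0 x1] := x01; elim: k => [|k IHk].
  rewrite qpoch0 mulr1 -(truncated_gf0 N x) truncated_gf_le //.
apply: le_trans IHk; rewrite qpochS mulrCA mulrC ler_wpM2r ?qpoch_ge0 //.
rewrite mulrBr mulr1 truncated_gfS lerBlDr lerD2l [leRHS]mulrC -truncated_gfS.
by rewrite ler_wpM2l ?exprn_ge0 ?truncated_gf_le ?leq_subr.
Qed.

Lemma bounded_partitions_expr_le k i (x d : K) :
    0 <= x < 1 -> 0 < d -> d <= qpoch x x k ->
  (bounded_partitions k i)%:R * x ^+ i <= d^-1.
Proof.
move=> x01 d0 dQ; have /andP[x0 x1] := x01.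
apply: (@le_trans _ _ (truncated_gf k i.+1 x)).
  rewrite /truncated_gf big_ord_recr /= lerDr sumr_ge0 // => j _.
  by rewrite mulr_ge0 ?ler0n ?exprn_ge0.
rewrite -div1r ler_pdivlMr //; apply: le_trans (truncated_gf_qpoch_le1 k i.+1 x01).
rewrite ler_wpM2l // sumr_ge0 // => j _.
by rewrite mulr_ge0 ?ler0n ?exprn_ge0.
Qed.

Lemma norm_qpoch_ge k (q : K) : `|q| < 1 -> qpoch `|q| `|q| k <= `|qpoch q q k|.
Proof.
move=> q1; rewrite /qpoch normr_prod; apply: ler_prod => i _.
rewrite -!exprS subr_ge0 exprn_ile1 ?(ltW q1) //= -normrX.
by rewrite -{1}[1]normr1 lerB_dist.
Qed.

(** Factor by factor, |1 - z| (1 - |z|) <= 1 - |z|^2 <= 1 for z = q^i, so a lower bound for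
    (|q|;|q|)_k yields an upper bound for |(q;q)_k|. *)
Lemma norm_qpoch_le k (q d : K) :
    `|q| < 1 -> 0 < d -> d <= qpoch `|q| `|q| k ->
  `|qpoch q q k| <= d^-1.
Proof.
move=> q1 d0 dQ; have q01 : 0 <= `|q| < 1 by rewrite normr_ge0.
rewrite -div1r ler_pdivlMr //.
apply: (@le_trans _ _ (`|qpoch q q k| * qpoch `|q| `|q| k)).
  by rewrite ler_wpM2l.
rewrite /qpoch normr_prod -big_split /=.
apply: prodr_ile1 => i _; rewrite -!exprS -normrX.
have qi1 : `|q ^+ i.+1| <= 1 by rewrite normrX exprn_ile1 ?(ltW q1).
rewrite mulr_ge0 ?subr_ge0 //=.
apply: (@le_trans _ _ ((1 + `|q ^+ i.+1|) * (1 - `|q ^+ i.+1|))).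
  rewrite ler_wpM2r ?subr_ge0 // (le_trans (ler_normB _ _)) // normr1 //.
by rewrite mulrC -subr_sqr expr1n gerBl exprn_ge0.
Qed.

(* The truncation at N commutes with multiplication by 1 - q^k up to the
   terms of index at least N - k, which are geometrically small. *)
Lemma qpoch_truncated_gf_bound (q r s A M : K) k N :
    0 <= r < 1 -> 0 <= s < 1 -> `|q| = r * s ->
    (forall j, `|qpoch q q j| <= A) ->
    (forall j i, (bounded_partitions j i)%:R * r ^+ i <= M) ->
    (k <= N.+1)%N ->
  `|qpoch q q k * truncated_gf k N.+1 q - 1|
     <= A * M / (1 - s) / (1 - r) * s ^+ N.+1.
Proof.
move=> r01 s01 qrs QA pM kN; have /andP[r0 r1] := r01; have /andP[s0 s1] := s01.
have A0 : 0 <= A by apply: le_trans (QA 0%N).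
have M0 : 0 <= M by apply: le_trans (pM 0%N 0%N); rewrite mulr_ge0 ?exprn_ge0.
have s1' : 0 <= (1 - s)^-1 by rewrite invr_ge0 subr_ge0 ltW.
set B := A * M / (1 - s).
have B0 : 0 <= B by rewrite !mulr_ge0.
(* Passing from k to k+1 costs at most B s^(N+1) r^k; the total stays below B s^(N+1) / (1 - r),
   uniformly in k. *)
suff h : `|qpoch q q k * truncated_gf k N.+1 q - 1|
         <= B * s ^+ N.+1 * \sum_(i < k) r ^+ (0 + i).
  apply: le_trans h _; rewrite -[leRHS]mulrA [_^-1 * _]mulrC mulrA.
  rewrite ler_wpM2l ?mulr_ge0 ?exprn_ge0 // -div1r.
  by rewrite -[1 in leRHS](expr0 r) sum_geometric_le.
elim: k kN => [|k IHk] kN.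
  by rewrite qpoch0 truncated_gf0 mul1r subrr normr0 big_ord0 mulr0.
rewrite big_ord_recr /= mulrDr qpochS.
set T := truncated_gf k.+1.
have -> : qpoch q q k * (1 - q ^+ k.+1) * T N.+1 q - 1 =
    (qpoch q q k * truncated_gf k N.+1 q - 1)
    - qpoch q q k * (q ^+ k.+1 * (T N.+1 q - T (N.+1 - k.+1)%N q)).
  by rewrite /T truncated_gfS; ring.
rewrite (le_trans (ler_normB _ _)) // lerD ?IHk ?(ltnW kN) //.
have -> : T N.+1 q - T (N.+1 - k.+1)%N q =
    \sum_(j < k.+1) (bounded_partitions k.+1 (N - k + j))%:R * q ^+ (N - k + j).
  have NE : N.+1 = (N - k + k.+1)%N by rewrite addnS subnK.
  by rewrite /T /truncated_gf [in X in X - _]NE big_split_ord /= subSS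
             addrAC subrr add0r.
set D := \sum_(j < _) _.
(* Since |q|^i = r^i s^i, each term is at most M s^i. *)
have DM : `|D| <= M * (s ^+ (N - k) / (1 - s)).
  apply: (@le_trans _ _ (M * \sum_(j < k.+1) s ^+ (N - k + j))).
    rewrite mulr_sumr (le_trans (ler_norm_sum _ _ _)) // ler_sum // => j _.
    rewrite normrM normr_nat normrX qrs exprMn mulrA.
    by rewrite ler_wpM2r ?exprn_ge0.
  by rewrite ler_wpM2l // sum_geometric_le.
rewrite !normrM normrX qrs.
(* The factor |q|^(k+1) restores the power of s lost by starting at N - k, as s^(k+1) s^(N-k) =
   s^(N+1); moreover r^(k+1) <= r^k. *)
have -> : B * s ^+ N.+1 * r ^+ (0 + k) =
    A * (r ^+ k * s ^+ k.+1 * (M * (s ^+ (N - k) / (1 - s)))).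
  rewrite add0n (_ : s ^+ N.+1 = s ^+ k.+1 * s ^+ (N - k)) /B; last first.
    by rewrite -exprD; congr (s ^+ _); lia.
  by ring.
have rs0 : 0 <= (r * s) ^+ k.+1 by rewrite exprn_ge0 ?mulr_ge0.
apply: ler_pM => //; first by rewrite mulr_ge0.
apply: ler_pM => //.
rewrite exprMn ler_wpM2r ?exprn_ge0 //.
by rewrite exprS ler_piMl ?exprn_ge0 // ltW.
Qed.

End TruncatedGeneratingFunction.

Lemma qpoch_ge (R : realType) (q : R[i]) : `|q| < 1 ->
  exists2 d : R, 0 < d & forall k, d%:C <= qpoch `|q| `|q| k.
Proof.
have [x x0 ->] := norm_complex_real q.
rewrite -(rmorph1 (real_complex R)) ltcR => x1.
have [|d d0 dQ] := @qpoch_ge_real R x; first by rewrite x0.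
exists d => // k; suff -> : qpoch x%:C x%:C k = (qpoch x x k)%:C by rewrite lecR.
rewrite /qpoch rmorph_prod; apply: eq_bigr => i _.
by rewrite rmorphB rmorph1 rmorphM rmorphXn.
Qed.

(** * Limits of (q;q)_n and of the partition sums *)

Section Limits.
Local Open Scope classical_set_scope.
Variable R : realType.
Local Notation C := (R[i] : numFieldType).

(** The increments - q^(n+1) Q n are geometrically small, which gives the limit a. The sums [v] of
    q^i / Q i also converge, to some b, and Q n * v (n+1) = 1 forces a b = 1, so a is nonzero. *)
Lemma cvg_qpoch (q : C) : `|q| < 1 ->
  exists2 l : C, l != 0 & qpoch q q n @[n --> \oo] --> l.
Proof.
move=> q1; have [d d0 dQ] := qpoch_ge q1.
have d0C : 0 < d%:C :> C by rewrite ltcR.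
have [x x0 xE] := norm_complex_real q.
have x01 : 0 <= x < 1 by rewrite x0 -ltcR -xE.
have /cvg_ex[/= a Qa] : cvgn (qpoch q q).
  have /cvg_ex[l ul] : cvgn (fun n => \sum_(i < n) (- q ^+ i.+1 * qpoch q q i : C)).
    apply: (@cvgn_series_geometric_bound _ (fun i => - q ^+ i.+1 * qpoch q q i)
              (d^-1 * x) x) => // n.
    rewrite normrM normrN normrX xE -mulrA -exprS rmorphM rmorphXn mulrC.
    rewrite ler_wpM2r ?exprn_ge0 ?ler0c // fmorphV.
    exact: (norm_qpoch_le q1 d0C (dQ n)).
  apply/cvg_ex; exists (1 + l).
  have -> : qpoch q q = (fun n => 1 + \sum_(i < n) (- q ^+ i.+1 * qpoch q q i : C)).
    apply/funext; elim=> [|n IHn]; first by rewrite qpoch0 big_ord0 addr0.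
    by rewrite big_ord_recr /= addrA -IHn qpochS; ring.
  by apply: cvgD; [apply: cvg_cst|apply: ul].
pose v n : C := \sum_(i < n) q ^+ i / qpoch q q i.
have /cvg_ex[/= b Vb] : cvgn v.
  apply: (@cvgn_series_geometric_bound _ (fun i => q ^+ i / qpoch q q i)
            d^-1 x) => // n.
  rewrite normrM normrX normfV xE rmorphM rmorphXn mulrC.
  rewrite ler_wpM2r ?exprn_ge0 ?ler0c // fmorphV lef_pV2 ?posrE //.
    exact: le_trans (dQ n) (norm_qpoch_ge n q1).
  by rewrite normr_gt0 qpoch_neq0.
exists a; last exact: Qa.
have ab1 : a * b = 1.
  have Vb1 : v n.+1 @[n --> \oo] --> (b : C) by rewrite (cvg_shiftS v).
  have Q_v : (fun n => qpoch q q n * v n.+1) = cst 1.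
    by apply/funext => n; rewrite /v sum_expr_qpochV // divff ?qpoch_neq0.
  have ab : (cst 1 : nat -> C) @ \oo --> (a * b : C).
    by rewrite -Q_v; apply: cvgM; [apply: Qa|apply: Vb1].
  have hC := @norm_hausdorff _ C.
  by rewrite -(cvg_lim hC ab); apply: (cvg_lim hC); apply: cvg_cst.
by apply: contra_eq_neq ab1 => ->; rewrite mul0r eq_sym oner_eq0.
Qed.

Definition partition_sums (q : C) (N : nat) : C :=
  \sum_(i < N) (num_partitions i)%:R * q ^+ i.

Lemma cvg_partition_sums (q l : C) : `|q| < 1 -> l != 0 ->
  qpoch q q n @[n --> \oo] --> l -> partition_sums q n @[n --> \oo] --> l^-1.
Proof.
move=> q1 l0 Ql.
have [x x0 xE] := norm_complex_real q.
have x1 : x < 1 by rewrite -ltcR -xE.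
(* The midpoint of |q| and 1 makes both r and |q| / r smaller than 1. *)
pose r := (1 + x) / 2; pose s := x / r.
have r01 : 0 < r < 1 by rewrite /r; lra.
have /andP[r0 r1] := r01.
have s01 : 0 <= s < 1.
  rewrite divr_ge0 ?(ltW r0) //= ltr_pdivrMr // mul1r /r; lra.
have rs : x = r * s by rewrite mulrCA divff ?mulr1 ?gt_eqF.
have rC1 : `|r%:C : C| < 1.
  by rewrite ger0_norm ?ler0c ?(ltW r0) // ltcR.
have [A A0 QA] := qpoch_ge q1; have [M M0 QM] := qpoch_ge rC1.
have A0C : 0 < A%:C :> C by rewrite ltcR.
have M0C : 0 < M%:C :> C by rewrite ltcR.
have QP1 : qpoch q q n * partition_sums q n @[n --> \oo] --> (1 : C).
  rewrite -cvg_shiftS.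
  pose c := A^-1 * M^-1 / (1 - s) / (1 - r) * s.
  apply: (@cvg_geometric_bound _ _ _ c s) => // n /=.
  (* A partition of i <= n has all parts at most n+1, so bounding the parts loses nothing; this is
     the extreme case k = N+1 of the error bound. *)
  have -> : partition_sums q n.+1 = truncated_gf n.+1 n.+1 q.
    by apply: eq_bigr => i _; rewrite bounded_partitions_full // ltnW.
  apply: le_trans (@qpoch_truncated_gf_bound _ q r%:C s%:C A^-1%:C M^-1%:C
                     n.+1 n _ _ _ _ _ _) _ => //.
  - by rewrite ler0c ltcR (ltW r0).
  - by rewrite ler0c ltcR.
  - by rewrite xE rs rmorphM.
  - by move=> j; rewrite fmorphV; apply: norm_qpoch_le.
  - move=> j i; rewrite fmorphV; apply: bounded_partitions_expr_le => //.
      by rewrite ler0c ltcR (ltW r0).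
    by have := QM j; rewrite ger0_norm // ler0c ltW.
  - by rewrite /c exprS !(rmorphM, rmorphXn, fmorphV, rmorphB, rmorph1) !mulrA.
have PE : (fun n => partition_sums q n) =
    (fun n => qpoch q q n * partition_sums q n * (qpoch q q n)^-1).
  by apply/funext => n; rewrite mulrAC divff ?mul1r ?qpoch_neq0.
have Vl := cvgV l0 Ql.
rewrite PE -[l^-1]mul1r; apply: cvgM.
  exact: QP1.
exact: Vl.
Qed.

(** [a] stands for the terms written in front of a series, and [n] is the index from which its
    partial sums have a closed form. *)
Lemma partial_sums_shift_cvg m (u f : nat -> C) (a l : C) n :
    (forall k, a + partial_sums m u (k + n)%N = f k) -> f @ \oo --> l ->
  converges m u /\ a + infsum m u = l.
Proof.
move=> uf fl; have ul : partial_sums m u @ \oo --> l - a.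
  rewrite -(cvg_shiftn n).
  have -> : (fun k => partial_sums m u (k + n)%N) = (fun k => f k - a).
    by apply/funext => k; rewrite -uf addrC addKr.
  by apply: cvgB; [apply: fl|apply: cvg_cst].
split; first exact: cvgP ul.
by rewrite /infsum (cvg_lim (@norm_hausdorff _ C) ul) addrC subrK.
Qed.

End Limits.

(** * Closed forms for the partial sums of the four series *)

Section PartialSums.
Variables (R : realType) (q : R[i]).
Hypothesis q1 : `|q| < 1.
Local Notation C := (R[i] : numFieldType).
Local Notation Q := (qpoch (q : C) q).
Local Notation P := (partition_sums (q : C)).

Lemma partition_sumsS k : P k.+1 = P k + (num_partitions k)%:R * q ^+ k.
Proof. by rewrite /partition_sums big_ord_recr. Qed.

(** Since c(N+1) = p(N) - p(N-1) for N >= 1, the sum is q (1 - q) times the partition series, the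
    shifted copy having one term fewer. *)
Lemma partial_sums_num_c k :
  partial_sums 1 (fun N => (num_c N)%:R * q ^+ N) (k + 2)%N
  = q * (P k.+1 - q * P k).
Proof.
rewrite addn2 /partial_sums; elim: k => [|k IHk].
  rewrite big_nat1 num_cS no_ones0 partition_sumsS /partition_sums big_ord0.
  rewrite -(@bounded_partitions_full 0) // bounded_partitions0 eqxx.
  by rewrite /= expr0 expr1; ring.
rewrite big_nat_recr //= IHk num_cS !partition_sumsS -no_onesS natrD !exprS.
by ring.
Qed.

Lemma partial_sums_num_e k :
  partial_sums 0 (fun N => (num_e N)%:R * q ^+ N) (k + 2)%N
  = P k.+2 - q * (P k.+1 - q * P k).
Proof.
rewrite -partial_sums_num_c addn2 /partial_sums; apply/eqP; rewrite eq_sym subr_eq.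
(* c(0) = 0, so both sums may start at 0 and be added termwise. *)
have -> : \sum_(1 <= N < k.+2) (num_c N)%:R * q ^+ N
          = \sum_(0 <= N < k.+2) (num_c N)%:R * q ^+ N.
  by rewrite [RHS]big_ltn // num_c0 mul0r add0r.
rewrite -big_split /= big_mkord; apply/eqP/eq_bigr => i _.
by rewrite -num_c_e addnC natrD mulrDl.
Qed.

(** The same expression as in [partial_sums_num_c] with P k replaced by 1 / Q k; the two sequences
    have the same limit. *)
Lemma partial_sums_c_double (c : nat -> C) k :
    (forall j, c j.+1 = q ^+ j.*2.+1 / Q j) ->
  q + partial_sums 2 c (k + 3)%N = q * ((Q k.+1)^-1 - q / Q k).
Proof.
move=> cE; rewrite addn3 /partial_sums.
have h0 := subr1_expS_neq0 q1; have hQ := qpoch_neq0 q1.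
elim: k => [|k IHk].
  rewrite big_nat1 cE qpochS qpoch0 /= expr1.
  by have := h0 0%N; rewrite expr1 => h; field.
rewrite big_nat_recr //= addrA IHk cE !qpochS.
have := hQ k; have := h0 k; have := h0 k.+1.
rewrite (_ : q ^+ _.*2.+1 = q * (q ^+ k.+2 * q ^+ k.+2)); last first.
  by rewrite -exprD -exprS; congr (q ^+ _); lia.
rewrite [q ^+ k.+2]exprS; set y := q ^+ k.+1 => h1 h2 h3.
by field; apply/and3P.
Qed.

(** The terms q^n / Q n rebuild 1 / Q and the others are those of the c double sum. The leading 1 +
    q^2 / (1 - q) is 1 plus q / Q 1 - q / Q 0, the value of the same formula at n = 1. *)
Lemma partial_sums_e_double (e : nat -> C) k :
    (forall j, e j.+2 = q ^+ j.+2 / Q j.+2 - q ^+ j.*2.+3 / Q j.+1) ->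
  1 + q ^+ 2 / (1 - q) + partial_sums 2 e (k + 3)%N
  = (Q k.+2)^-1 - q * ((Q k.+1)^-1 - q / Q k).
Proof.
move=> eE; rewrite addn3 /partial_sums.
have h0 := subr1_expS_neq0 q1; have hQ := qpoch_neq0 q1.
elim: k => [|k IHk].
  rewrite big_nat1 eE !qpochS qpoch0 /= expr1 !mul1r.
  have := h0 0%N; have := h0 1%N; rewrite expr1 => h h'.
  by field; apply/andP.
rewrite big_nat_recr //= addrA IHk eE !qpochS.
have := hQ k; have := h0 k; have := h0 k.+1; have := h0 k.+2.
rewrite (_ : q ^+ _.*2.+3 = q * (q ^+ k.+2 * q ^+ k.+2)); last first.
  by rewrite -exprD -exprS; congr (q ^+ _); lia.
rewrite [q ^+ k.+3]exprS [q ^+ k.+2]exprS; set y := q ^+ k.+1 => h1 h2 h3 h4.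
by field; apply/and4P.
Qed.

End PartialSums.

Theorem theorem6p1 (R : realType) (q : R[i]) (hq : `|q| < 1) :
  let c_series := fun N : nat => (num_c N)%:R * q ^+ N in
  let c_double := fun n : nat =>
    \sum_(0 <= m < n.+1)
      gauss_binom (2 * n%:Z - m%:Z - 2) (n%:Z - m%:Z - 1) q
        * (q ^+ (m * n + 2 * n - 1) / qpoch q q m) in
  let e_series := fun N : nat => (num_e N)%:R * q ^+ N in
  let e_double := fun n : nat =>
    \sum_(0 <= m < n.+1)
      gauss_binom (2 * n%:Z - m%:Z - 2) (n%:Z - m%:Z) q
        * (q ^+ (m * n + n) / qpoch q q m) in
  [/\ converges 1 c_series,
      converges 2 c_double,
      infsum 1 c_series = q + infsum 2 c_double
    & q + infsum 2 c_double = q / qpoch_inf (q ^+ 2) q]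
  /\
  [/\ converges 0 e_series,
      converges 2 e_double,
      infsum 0 e_series = 1 + q ^+ 2 / (1 - q) + infsum 2 e_double
    & 1 + q ^+ 2 / (1 - q) + infsum 2 e_double
        = (1 - q + q ^+ 2) / qpoch_inf q q].
Proof.
move=> c_series c_double e_series e_double.
pose C : numFieldType := R[i]; pose q' : C := q.
have [l l0 Ql] := cvg_qpoch hq.
have Vl : ((qpoch q' q' n)^-1 @[n --> \oo] --> l^-1)%classic by apply: cvgV.
have Pl := cvg_partition_sums hq l0 Ql.
(* [u] is general because the limit is taken both for the partition sums and for 1 / (q;q)_k. *)
have cvg1 (u : nat -> C) : (u k @[k --> \oo] --> l^-1)%classic ->
    (q' * (u k.+1 - q' * u k) @[k --> \oo] --> q' * (l^-1 - q' * l^-1))%classic.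
  move=> ul; apply: cvgM; first exact: cvg_cst.
  apply: cvgB; first by rewrite cvg_shiftS.
  by apply: cvgM; [apply: cvg_cst|apply: ul].
have cvg2 (u : nat -> C) : (u k @[k --> \oo] --> l^-1)%classic ->
    (u k.+2 - q' * (u k.+1 - q' * u k) @[k --> \oo]
      --> l^-1 - q' * (l^-1 - q' * l^-1))%classic.
  move=> ul; apply: cvgB; last exact: cvg1.
  have -> : (fun k => u k.+2) = (fun k => u (k + 2)%N).
    by apply/funext => k; rewrite addn2.
  by rewrite (cvg_shiftn 2).
have cE k : c_double k.+1 = q' ^+ k.*2.+1 / qpoch q' q' k.
  exact: (@c_doubleE C q' hq).
have eE k : e_double k.+2 = q' ^+ k.+2 / qpoch q' q' k.+2
                            - q' ^+ k.*2.+3 / qpoch q' q' k.+1.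
  exact: (@e_doubleE C q' hq).
have [c_cvg c_sum] : converges 1 c_series /\
    0 + infsum 1 c_series = q' * (l^-1 - q' * l^-1).
  apply: (@partial_sums_shift_cvg R 1 c_series _ 0 _ 2 _ (cvg1 _ Pl)) => k.
  by rewrite add0r; apply: partial_sums_num_c.
have [cd_cvg cd_sum] : converges 2 c_double /\
    q + infsum 2 c_double = q' * (l^-1 - q' * l^-1).
  apply: (@partial_sums_shift_cvg R 2 c_double _ q _ 3 _ (cvg1 _ Vl)) => k.
  exact: partial_sums_c_double.
have [e_cvg e_sum] : converges 0 e_series /\
    0 + infsum 0 e_series = l^-1 - q' * (l^-1 - q' * l^-1).
  apply: (@partial_sums_shift_cvg R 0 e_series _ 0 _ 2 _ (cvg2 _ Pl)) => k.
  by rewrite add0r; apply: partial_sums_num_e.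
have [ed_cvg ed_sum] : converges 2 e_double /\
    1 + q ^+ 2 / (1 - q) + infsum 2 e_double = l^-1 - q' * (l^-1 - q' * l^-1).
  apply: (@partial_sums_shift_cvg R 2 e_double _ _ _ 3 _ (cvg2 _ Vl)) => k.
  exact: partial_sums_e_double.
have hC := @norm_hausdorff _ C.
have Qinf : qpoch_inf q' q' = l by apply: (cvg_lim hC); exact: Ql.
have Q2inf : qpoch_inf (q' ^+ 2) q' = l / (1 - q').
  apply: (cvg_lim hC).
  have -> : qpoch (q' ^+ 2) q' = fun k => qpoch q' q' k.+1 / (1 - q').
    by apply/funext => k; apply: qpoch_sqrE.
  by apply: cvgM; [rewrite (cvg_shiftS (qpoch q' q')); exact: Ql|exact: cvg_cst].
have q1 : 1 - q' != 0 by have := @subr1_expS_neq0 C q' hq 0; rewrite expr1.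
rewrite add0r in c_sum; rewrite add0r in e_sum.
(* The limits are q (1 - q) / l and (1 - q (1 - q)) / l, where l = (q;q)_oo and (q^2;q)_oo = l / (1
   - q). *)
split; split=> //.
- by rewrite c_sum cd_sum.
- rewrite cd_sum -[qpoch_inf _ _]/(qpoch_inf (q' ^+ 2) q') Q2inf -/q'.
  by field; apply/andP.
- by rewrite e_sum ed_sum.
- by rewrite ed_sum -[qpoch_inf _ _]/(qpoch_inf q' q') Qinf -/q'; field.
Qed.
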